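(* Let $k\ge 1$ be an integer and let $\mathcal{H}\subseteq FIN_k^{[\infty]}$ be a semiselective Gowers coideal of block sequences. Then for every $\mathcal{X}\subseteq FIN_k^{[\infty]}$: (1) $\mathcal{X}$ is $\mathcal{H}$-Ramsey if and only if $\mathcal{X}$ is $\mathcal{H}$-Baire; (2) $\mathcal{X}$ is $\mathcal{H}$-Ramsey null if and only if $\mathcal{X}$ is $\mathcal{H}$-nowhere dense.
   Context: Block sequences. Let $\mathbb{N}=\{0,1,2,\dots\}$ and fix an integer $k\ge 1$. $FIN_k$ is the set of functions $p:\mathbb{N}\to\{0,1,\dots,k\}$ whose support $supp(p)=\{n: p(n)\ne 0\}$ is finite and whose image contains $k$. A block sequence is a finite (possibly empty) or infinite (indexed in order type $\mathbb{N}$) sequence of elements of $FIN_k$ such that $\max(supp(x))<\min(supp(y))$ whenever $x$ precedes $y$; it is identified with its set of terms. $FIN_k^{[\infty]}$, $FIN_k^{[<\infty]}$ and $FIN_k^{[n]}$ are the sets of infinite, finite, and length-$n$ block sequences; $|a|$ is the length of $a$. For $j\in\mathbb{N}$ put $T^{(j)}(p)(n)=\max\{p(n)-j,0\}$. For a finite or infinite block sequence $A=(a_n)_{n\in I}$, $[A]\subseteq FIN_k$ is the set of all functions $T^{(j_0)}(a_{n_0})+\cdots+T^{(j_r)}(a_{n_r})$ with $n_0<\cdots<n_r$ in $I$, $j_0,\dots,j_r\in\{0,1,\dots,k\}$ and $j_i=0$ for at least one $i$. $A\le B$ means $A\subseteq[B]$. $A\upharpoonright n$ is the sequence of the first $n$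 terms of $A$ ($A\upharpoonright 0=\emptyset$), and $a\sqsubset B$ means $a=B\upharpoonright n$ for some $n$. For a finite block sequence $a$, $supp(a)$ is the union of the supports of its terms; $a<b$ means $\max(supp(a))<\min(supp(b))$ (always true if $a=\emptyset$). $A/a=\{b\in A: a<b\}$. For $a\in FIN_k^{[<\infty]}$ and $A\in FIN_k^{[\infty]}$, $[a,A]=\{B\in FIN_k^{[\infty]}: a\sqsubset B \text{ and } B/a\subseteq[A]\}$; in particular $[\emptyset,A]=\{B\in FIN_k^{[\infty]}: B\le A\}$. Coideals. $\mathcal{H}\subseteq FIN_k^{[\infty]}$ is a coideal of block sequences if (i) $A\le B$ and $A\in\mathcal{H}$ (with $A,B\in FIN_k^{[\infty]}$) imply $B\in\mathcal{H}$; and (ii) for every $A\in\mathcal{H}$ and every partition $A=B\cup C$ there is $D\in\mathcal{H}$ with $D\le B$ or $D\le C$. Write $\mathcal{H}\upharpoonright A=\{B\in\mathcal{H}: B\le A\}$. $\mathcal{H}$ is Gowers if for every integer $r>0$, every $A\in\mathcal{H}$ and every $f:FIN_k\to\{0,\dots,r-1\}$ there is $B\in\mathcal{H}\upharpoonright A$ such that $f$ is constant on $[B]$. A set $\mathcal{D}\subseteq\mathcal{H}$ is dense open in $(\mathcal{H},\le)$ if $B\in\mathcal{D}$, $A\in\mathcal{H}$, $A\le B$ imply $A\in\mathcal{D}$, and for every $A\in\mathcal{H}$ there is $B\in\mathcal{D}$ with $B\le A$. If $(A_n)_{n\in\mathbb{N}}$ is a $\le$-decreasing sequence in $FIN_k^{[\infty]}$,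 then $B\in FIN_k^{[\infty]}$ is a diagonalization of $(A_n)_n$ if $B/b\le A_n$ for every $b\in[B]$, where $n=\max(supp(b))$. $\mathcal{H}$ is semiselective if for every $A\in\mathcal{H}$ and every sequence $(\mathcal{D}_n)_{n\in\mathbb{N}}$ of dense open subsets of $(\mathcal{H},\le)$ there are a $\le$-decreasing sequence $(A_n)_n$ with $A_n\in\mathcal{D}_n$ for all $n$ and some $B\in\mathcal{H}\upharpoonright A$ which is a diagonalization of $(A_n)_n$. Ramsey and Baire properties. $\mathcal{X}\subseteq FIN_k^{[\infty]}$ is $\mathcal{H}$-Ramsey if for all $A\in\mathcal{H}$ and $a\in FIN_k^{[<\infty]}$ there is $B\in[a,A]\cap\mathcal{H}$ with $[a,B]\subseteq\mathcal{X}$ or $[a,B]\cap\mathcal{X}=\emptyset$; it is $\mathcal{H}$-Ramsey null if for all such $A,a$ there is $B\in[a,A]\cap\mathcal{H}$ with $[a,B]\cap\mathcal{X}=\emptyset$. $\mathcal{X}$ is $\mathcal{H}$-Baire if for all $A\in\mathcal{H}$ and $a\in FIN_k^{[<\infty]}$ there are $b\in FIN_k^{[<\infty]}$ and $B\in\mathcal{H}$ with $[b,B]\subseteq[a,A]$ such that $[b,B]\subseteq\mathcal{X}$ or $[b,B]\cap\mathcal{X}=\emptyset$; it is $\mathcal{H}$-nowhere dense if for all such $A,a$ there are $b\in FIN_k^{[<\infty]}$ and $B\in\mathcal{H}$ with $[b,B]\subseteq[a,A]$ and $[b,B]\cap\mathcal{X}=\emptyset$. *)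

(* Defs.v *)
From HB Require Import structures.
From mathcomp Require Import all_boot finmap boolp classical_sets.

Set Implicit Arguments.
Unset Strict Implicit.
Unset Printing Implicit Defensive.

Local Open Scope nat_scope.
Local Open Scope classical_set_scope.

Record FIN (k : nat) := MkFIN {
  FIN_fun :> {fsfun nat -> 'I_k.+1 with ord0};
  _ : `[< exists n, FIN_fun n = ord_max >] }.

HB.instance Definition _ (k : nat) := [isSub for @FIN_fun k].
HB.instance Definition _ (k : nat) := [Choice of FIN k by <:].

(* Junk values on the empty set: smax = smin = 0. *)
Definition smax (S : {fset nat}) : nat := \max_(n <- S) n.
Definition smin (S : {fset nat}) : nat := \big[minn/smax S]_(n <- S) n.

Definition blt (k : nat) (x y : FIN k) : bool :=
  smax (finsupp x) < smin (finsupp y).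

Record finBlock (k : nat) := MkFinBlock {
  finBlock_seq :> seq (FIN k);
  _ : pairwise (@blt k) finBlock_seq }.

HB.instance Definition _ (k : nat) := [isSub for @finBlock_seq k].
HB.instance Definition _ (k : nat) := [Choice of finBlock k by <:].

Record infBlock (k : nat) := MkInfBlock {
  infBlock_fun :> nat -> FIN k;
  infBlockP : forall m n, m < n -> blt (infBlock_fun m) (infBlock_fun n) }.

Definition terms (k : nat) (A : infBlock k) : set (FIN k) := range A.

(* [span S] is $[S]$ for a finite or infinite block sequence given by its set
   of terms S: in a block sequence, n_0 < ... < n_r means that the selected
   terms are in block order. The pair (a, j) stands for T^(j)(a), and
   truncated subtraction on nat gives max{a(n) - j, 0}. *)
Definition span (k : nat) (S : set (FIN k)) : set (FIN k) :=
  [set p : FIN k | exists s : seq (FIN k * 'I_k.+1),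
    [/\ pairwise (@blt k) (unzip1 s),
        forall aj, aj \in s -> S aj.1,
        exists2 aj, aj \in s & aj.2 = ord0
      & forall n : nat, (p n : nat) = \sum_(aj <- s) ((aj.1 n : nat) - aj.2)]].

Definition bleS (k : nat) (S S' : set (FIN k)) : Prop := S `<=` span S'.

Definition ble (k : nat) (A B : infBlock k) : Prop := bleS (terms A) (terms B).

Definition supp (k : nat) (a : seq (FIN k)) : {fset nat} :=
  (\bigcup_(x <- a) finsupp x)%fset.

Definition before (k : nat) (a : seq (FIN k)) (b : FIN k) : bool :=
  nilp a || (smax (supp a) < smin (finsupp b)).

(* A/a; for a single b in FIN_k, A/b is [above A [:: b]]. *)
Definition above (k : nat) (A : infBlock k) (a : seq (FIN k)) : set (FIN k) :=
  [set b | terms A b /\ before a b].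

Definition initial (k : nat) (a : finBlock k) (B : infBlock k) : Prop :=
  exists n : nat, finBlock_seq a = mkseq B n.

Definition basic (k : nat) (a : finBlock k) (A : infBlock k) :
    set (infBlock k) :=
  [set B | initial a B /\ above B a `<=` span (terms A)].

(* Every subset of the terms of A is (the set of terms of) a finite or
   infinite block sequence, so partitions of A are partitions of [terms A]. *)
Definition coideal (k : nat) (H : set (infBlock k)) : Prop :=
  (forall A B : infBlock k, ble A B -> H A -> H B) /\
  (forall (A : infBlock k) (B C : set (FIN k)),
     H A -> terms A = B `|` C -> B `&` C = set0 ->
     exists2 D : infBlock k, H D & bleS (terms D) B \/ bleS (terms D) C).

Definition below (k : nat) (H : set (infBlock k)) (A : infBlock k) :
    set (infBlock k) :=
  [set B | H B /\ ble B A].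

Definition gowers (k : nat) (H : set (infBlock k)) : Prop :=
  forall (r : nat) (A : infBlock k) (f : FIN k -> 'I_r), 0 < r -> H A ->
    exists2 B : infBlock k, below H A B &
      exists c : 'I_r, forall p : FIN k, span (terms B) p -> f p = c.

Definition dense_open (k : nat) (H D : set (infBlock k)) : Prop :=
  [/\ D `<=` H,
      forall A B : infBlock k, D B -> H A -> ble A B -> D A
    & forall A : infBlock k, H A -> exists2 B : infBlock k, D B & ble B A].

Definition decreasing (k : nat) (A : nat -> infBlock k) : Prop :=
  forall m n : nat, m <= n -> ble (A n) (A m).

Definition diagonalization (k : nat) (A : nat -> infBlock k) (B : infBlock k) :
    Prop :=
  forall b : FIN k, span (terms B) b ->
    bleS (above B [:: b]) (terms (A (smax (finsupp b)))).

Definition semiselective (k : nat) (H : set (infBlock k)) : Prop :=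
  forall (A : infBlock k) (D : nat -> set (infBlock k)),
    H A -> (forall n : nat, dense_open H (D n)) ->
    exists An : nat -> infBlock k,
      [/\ decreasing An, forall n : nat, D n (An n)
        & exists2 B : infBlock k, below H A B & diagonalization An B].

Definition H_Ramsey (k : nat) (H X : set (infBlock k)) : Prop :=
  forall (A : infBlock k) (a : finBlock k), H A ->
    exists2 B : infBlock k, (basic a A `&` H) B &
      basic a B `<=` X \/ basic a B `&` X = set0.

Definition H_Ramsey_null (k : nat) (H X : set (infBlock k)) : Prop :=
  forall (A : infBlock k) (a : finBlock k), H A ->
    exists2 B : infBlock k, (basic a A `&` H) B & basic a B `&` X = set0.

Definition H_Baire (k : nat) (H X : set (infBlock k)) : Prop :=
  forall (A : infBlock k) (a : finBlock k), H A ->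
    exists (b : finBlock k) (B : infBlock k),
      [/\ H B, basic b B `<=` basic a A
        & basic b B `<=` X \/ basic b B `&` X = set0].

Definition H_nowhere_dense (k : nat) (H X : set (infBlock k)) : Prop :=
  forall (A : infBlock k) (a : finBlock k), H A ->
    exists (b : finBlock k) (B : infBlock k),
      [/\ H B, basic b B `<=` basic a A & basic b B `&` X = set0].

(* Main.v *)
Require Import Defs.
From mathcomp Require Import all_boot finmap boolp classical_sets.
From mathcomp Require Import zify.

(* Ellentuck-style combinatorial forcing. Say that [A] accepts [c] if every
   block sequence in the cone [c, A] lies in X, and rejects [c] if no [B <= A]
   in H accepts it. Deciding [c] is dense open in H, so semiselectivity yields
   some [B] in H deciding all end-extensions of [a] by blocks of [B]. If [B]
   rejects [c], colour the [p] in [B] by whether [B] accepts [c ^ p]: by the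
   Gowers property one colour is constant on some [C <= B], and it must be
   rejection, as otherwise [C] would accept [c]. Fusing again, a rejected [a]
   gives some [B] rejecting all end-extensions of [a] by blocks of [B]. Apply
   this to X and then to its complement: if both were rejected, the resulting
   [C] would contradict the H-Baire property inside the cone [a, C]. *)

Set Implicit Arguments.
Unset Strict Implicit.
Unset Printing Implicit Defensive.

Local Open Scope nat_scope.
Local Open Scope classical_set_scope.

(** * Supports and the block order *)

Section Blocks.
Variables (k : nat) (hk : 0 < k).
Implicit Types (x y p q : FIN k) (c : seq (FIN k)) (A B : infBlock k).
Implicit Types (S : set (FIN k)).

Lemma mem_FIN x n : (n \in finsupp x) = (0 < x n).
Proof. by rewrite mem_finsupp lt0n. Qed.

Lemma FIN_peak x : exists n, x n = k :> nat.
Proof. by case: x => f /= /asboolP[n fn]; exists n; rewrite fn. Qed.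

Lemma smax_ge (s : {fset nat}) n : n \in s -> n <= smax s.
Proof. by move=> ns; exact: (leq_bigmax_seq n). Qed.

Lemma smin_le (s : {fset nat}) n : n \in s -> smin s <= n.
Proof.
rewrite /smin; move: (smax s) => M.
have -> : n \in s = (n \in enum_fset s) by [].
elim: (enum_fset s) => [|m r IH] //=; rewrite inE big_cons geq_min.
by case/predU1P => [->|nr]; rewrite ?leqnn // IH ?orbT.
Qed.

(** Positivity of [m] covers the empty set, where [smax] is 0. *)
Lemma smax_lt (s : {fset nat}) m :
  0 < m -> (forall n, n \in s -> n < m) -> smax s < m.
Proof.
move=> m0 lts; rewrite -[m]prednK // ltnS; apply/bigmax_leqP_seq => n ns _.
by rewrite -ltnS prednK // lts.
Qed.

Lemma smin_gt (s : {fset nat}) m n0 :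
  n0 \in s -> (forall n, n \in s -> m < n) -> m < smin s.
Proof.
move=> n0s gts.
have : m < smax s by apply: leq_trans (gts _ n0s) _; exact: smax_ge.
rewrite /smin; move: (smax s) => M mM.
have : forall n, n \in enum_fset s -> m < n by move=> n /gts.
elim: (enum_fset s) => [|a r IH] gtr; rewrite ?big_nil ?big_cons // leq_min.
by rewrite gtr ?mem_head // IH // => n nr; rewrite gtr // inE nr orbT.
Qed.

(** Each block attains k > 0, so supports are nonempty and the junk values of [smax] and [smin]
    never intervene. *)
Lemma bltP x y :
  reflect (forall m n, 0 < x m -> 0 < y n -> m < n) (blt x y).
Proof.
apply: (iffP idP) => [xy m n xm yn|xy].
  apply: leq_ltn_trans (smax_ge _) (leq_trans xy (smin_le _)); by rewrite mem_FIN.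
have [m xm] := FIN_peak x; have [n yn] := FIN_peak y.
have yn0 : 0 < y n by rewrite yn.
have xm0 : 0 < x m by rewrite xm.
apply: (@smin_gt _ _ n) => [|i]; rewrite mem_FIN // => yi.
apply: smax_lt => [|j]; first by have := xy _ _ xm0 yi; lia.
by rewrite mem_FIN => xj; exact: xy.
Qed.

Lemma blt_irr x : blt x x = false.
Proof.
apply/negP => /bltP xx; have [m xm] := FIN_peak x.
by have := xx m m; rewrite ltnn xm hk => /(_ isT isT).
Qed.

Lemma blt_trans : transitive (@blt k).
Proof.
move=> y x z /bltP xy /bltP yz; apply/bltP => m n xm zn.
have [i yi] := FIN_peak y; have yi0 : 0 < y i by rewrite yi.
exact: ltn_trans (xy _ _ xm yi0) (yz _ _ yi0 zn).
Qed.

Lemma beforeP c x : reflect (forall y, y \in c -> blt y x) (before c x).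
Proof.
have suppP m : reflect (exists2 y, y \in c & 0 < y m) (m \in supp c).
  apply: (iffP (bigfcupP _ _ _ _)) => -[y]; rewrite ?andbT => yc ym; exists y => //.
  - by rewrite -mem_FIN.
  - by rewrite yc.
  - by rewrite mem_FIN.
rewrite /before; apply: (iffP orP) => [[/nilP->//|cx] y yc|cx].
  apply/bltP => m n ym xn; apply: leq_ltn_trans (smax_ge _) (leq_trans cx (smin_le _)).
    by apply/suppP; exists y.
  by rewrite mem_FIN.
case: c suppP cx => [|y c] suppP cx; [by left|right].
have [n xn] := FIN_peak x; have xn0 : 0 < x n by rewrite xn.
apply: (@smin_gt _ _ n) => [|i]; rewrite mem_FIN // => xi.
have ltc m : m \in supp (y :: c) -> m < i.
  by case/suppP => z /cx /bltP zx zm; exact: zx.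
apply: smax_lt ltc.
have [m ym] := FIN_peak y; have ym0 : 0 < y m by rewrite ym.
have /bltP yx := cx y (mem_head _ _); have := yx _ _ ym0 xi; lia.
Qed.

Lemma infBlock_inj A : injective A.
Proof. by move=> i j e; case: (ltngtP i j) => // /(infBlockP A); rewrite e blt_irr. Qed.

Lemma term_index_le A i n : 0 < A i n -> i <= n.
Proof.
elim: i n => // i IH n Ain; have [m Am] := FIN_peak (A i).
have Am0 : 0 < A i m by rewrite Am.
apply: leq_ltn_trans (IH _ Am0) _.
by have /bltP := infBlockP A (ltnSn i); apply.
Qed.

(** * Spans described by shift functions *)

Definition disjoint_terms S := forall x y n,
  S x -> S y -> 0 < x n -> 0 < y n -> x = y.

Lemma terms_disjoint A : disjoint_terms (terms A).
Proof.
move=> _ _ n [i _ <-] [j _ <-] in_ jn; case: (ltngtP i j) => [ij|ij|->//].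
  by have /bltP/(_ _ _ in_ jn) := infBlockP A ij; rewrite ltnn.
by have /bltP/(_ _ _ jn in_) := infBlockP A ij; rewrite ltnn.
Qed.

(* [g a] is the shift applied to [a]; a shift [g a >= k] discards [a], so
   finiteness of the sum is automatic from the finite support of [p]. *)
Definition spanned S p := exists g : FIN k -> nat,
  [/\ forall a n, S a -> 0 < a n -> p n = a n - g a :> nat,
      forall n, 0 < p n -> exists2 a, S a & 0 < a n
    & exists2 a, S a & g a = 0].

Lemma span_supp S p n : span S p -> 0 < p n -> exists2 a, S a & 0 < a n.
Proof.
case=> s [_ sS _ pE]; rewrite pE lt0n => /eqP s0.
have [/hasP[[a j] ajs /= an]|/hasPn h] :=
  boolP (has (fun aj : FIN k * 'I_k.+1 => 0 < aj.1 n) s).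
  by exists a => //; exact: (sS _ ajs).
case: s0; apply: big1_seq => -[a j] /andP[_ ajs] /=.
by have := h _ ajs; rewrite -leqNgt leqn0 /= => /eqP->.
Qed.

Lemma uniq_map_inj_in (T U : eqType) (f : T -> U) (s : seq T) :
  uniq (map f s) -> {in s &, injective f}.
Proof.
elim: s => [|z s IH] //= /andP[zs us] x y; rewrite !inE.
case/predU1P => [->|xs]; case/predU1P => [->|ys] // e; last exact: IH.
  by rewrite e map_f in zs.
by rewrite -e map_f in zs.
Qed.

Lemma blt_uniq c : pairwise (@blt k) c -> uniq c.
Proof. by apply: pairwise_uniq => x; exact: blt_irr. Qed.

Lemma span_spanned S p : disjoint_terms S -> span S p -> spanned S p.
Proof.
move=> dS pS; have pS' n := span_supp pS (n := n).
case: pS => s [/blt_uniq us sS [[a0 j0] a0s /= j00] pE].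
(* A term is listed at most once, so its shift is well defined; an unlisted term gets shift k, which
   discards it. *)
pose g a := if [pick j | (a, j) \in s] is Some j then nat_of_ord j else k.
have gE a j : (a, j) \in s -> g a = j.
  rewrite /g; case: pickP => [j' aj' aj|/(_ j)->//].
  by have [->] := uniq_map_inj_in us aj' aj erefl.
have gN a : a \notin unzip1 s -> g a = k.
  rewrite /g; case: pickP => // j aj /negP[]; by apply/mapP; exists (a, j).
exists g; split=> //; last by exists a0; [exact: sS a0s | rewrite (gE _ _ a0s) j00].
move=> a n aS an; rewrite pE.
have others aj : aj \in s -> aj.1 != a -> aj.1 n - aj.2 = 0.
  move=> ajs /eqP ne; have [->|] := posnP (aj.1 n); first by rewrite sub0n.
  by move=> ajn; case: ne; apply: dS (sS _ ajs) aS ajn an.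
have [/mapP[[a' j] ajs /= e]|aN] := boolP (a \in unzip1 s).
  move: ajs; rewrite -e => ajs.
  rewrite (gE _ _ ajs) (bigD1_seq (a, j)) ?(map_uniq us) //=.
  rewrite big1_seq ?addn0 // => -[b i] /andP[ne bis]; apply: others => //=.
  apply: contraNneq ne => /= e'; move: bis; rewrite e' => bis.
  by have := gE _ _ bis; rewrite (gE _ _ ajs) => /val_inj ->.
rewrite (gN _ aN) big1_seq => [|aj /andP[_ ajs]].
  by apply/esym/eqP; rewrite subn_eq0 -ltnS ltn_ord.
apply: others => //; apply: contraNneq aN => <-; exact: map_f.
Qed.

Lemma spanned_span A p : spanned (terms A) p -> span (terms A) p.
Proof.
case=> g [gE pS [_ [i0 _ <-] gi0]].
(* By [term_index_le], terms meeting the support of [p] have index below [N]; [i0] keeps a term with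
   shift 0. Capping shifts at k is harmless, as values are at most k. *)
pose N := (maxn (smax (finsupp p)) i0).+1.
pose j i : 'I_k.+1 := inord (minn k (g (A i))).
have jE i : j i = minn k (g (A i)) :> nat by rewrite inordK // ltnS geq_minl.
have subj i n : A i n - j i = A i n - g (A i).
  by rewrite jE; have := ltn_ord (A i n); lia.
exists [seq (A i, j i) | i <- iota 0 N]; split.
- rewrite /unzip1 -map_comp pairwise_map.
  rewrite -sorted_pairwise; last by move=> ? ? ?; exact: blt_trans.
  by apply: sub_sorted (iota_ltn_sorted 0 N) => i i'; exact: infBlockP.
- by move=> _ /mapP[i _ ->]; exists i.
- exists (A i0, j i0); first by apply/mapP; exists i0; rewrite // mem_iota /N; lia.
  by apply: val_inj; rewrite /= jE gi0 minn0.
move=> n; rewrite big_map.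
under eq_bigr do rewrite /= subj.
have [pn|pn] := posnP (p n).
  rewrite pn big1 // => i _; have [->|Ain] := posnP (A i n); first by rewrite sub0n.
  by rewrite -gE //; exists i.
have [_ [i _ <-] Ain] := pS _ pn.
have iN : i \in iota 0 N.
  rewrite mem_iota /= add0n ltnS leq_max; apply/orP; left.
  apply: leq_trans (term_index_le Ain) _; apply: smax_ge; by rewrite mem_FIN.
rewrite (bigD1_seq i) ?iota_uniq //= big1 ?addn0 => [|i' ne].
  by apply: gE => //; exists i.
have [->|Ai'n] := posnP (A i' n); first by rewrite sub0n.
case/eqP: ne; apply: (@infBlock_inj A).
by apply: (@terms_disjoint A _ _ n) => //; [exists i'|exists i].
Qed.

Lemma spanP A p : span (terms A) p <-> spanned (terms A) p.
Proof.
by split; [apply: span_spanned; exact: terms_disjoint | exact: spanned_span].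
Qed.

Lemma span_sub S : S `<=` span S.
Proof.
move=> p Sp; exists [:: (p, ord0)]; split=> //.
- by move=> aj; rewrite inE => /eqP->.
- by exists (p, ord0); rewrite ?mem_head.
- by move=> n; rewrite big_seq1 subn0.
Qed.

Lemma span_mono S S' : S `<=` S' -> span S `<=` span S'.
Proof. by move=> SS' p [s [? sS ? ?]]; exists s; split=> // aj /sS/SS'. Qed.

(* Shifts add up: a term used by an element [q] of [S'] takes the value [k]
   somewhere in the support of [q], so disjointness leaves only one such [q]. *)
Lemma spanned_trans S S' : disjoint_terms S -> disjoint_terms S' ->
  S' `<=` spanned S -> spanned S' `<=` spanned S.
Proof.
move=> dS dS' S'S p [g [gE gS' [q0 q0S' gq0]]].
have /choice[h hP] : forall q, exists h, S' q ->
    [/\ forall a n, S a -> 0 < a n -> q n = a n - h a :> nat,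
      forall n, 0 < q n -> exists2 a, S a & 0 < a n
    & exists2 a, S a & h a = 0].
  move=> q; case: (pselect (S' q)) => [/S'S[h ?]|]; first by exists h.
  by exists (fun=> 0).
have hU a q q' : S a -> S' q -> S' q' -> h q a < k -> h q' a < k -> q = q'.
  move=> aS qS' q'S' hq hq'; have [n an] := FIN_peak a.
  have an0 : 0 < a n by rewrite an.
  apply: (dS' _ _ n) => //.
    by have [/(_ a n aS an0)-> _ _] := hP _ qS'; rewrite an subn_gt0.
  by have [/(_ a n aS an0)-> _ _] := hP _ q'S'; rewrite an subn_gt0.
(* [h q a < k] says that [q] uses [a], and then the shifts add. A term used by no member of [S'] is
   discarded. *)
pose f a := if pselect (exists q, S' q /\ h q a < k) is left e
            then let q := sval (cid e) in g q + h q a else k.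
have fE a q : S a -> S' q -> h q a < k -> f a = g q + h q a.
  move=> aS qS' hq; rewrite /f; case: pselect => [e|[]]; last by exists q.
  by case: cid => q' /= [q'S' hq']; rewrite (hU a q q').
exists f; split.
- move=> a n aS an.
  have pE q : S' q -> 0 < q n -> h q a < k /\ p n = a n - f a :> nat.
    move=> qS' qn; have [hE _ _] := hP _ qS'.
    have hq : h q a < k.
      by move: qn; rewrite (hE a) // subn_gt0 => /leq_trans; apply; rewrite -ltnS ltn_ord.
    by split=> //; rewrite (fE a q) // (gE q) // (hE a) // -subnDA addnC.
  have [p0|/gS'[q qS' /(pE _ qS')[]//]] := posnP (p n).
  rewrite p0; apply/esym/eqP; rewrite subn_eq0 /f.
  case: pselect => [e|_]; last by rewrite -ltnS ltn_ord.
  case: cid => q /= [qS' hq]; have [hE _ _] := hP _ qS'.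
  have [qn|qn] := posnP (q n); first by move: (hE _ _ aS an); rewrite qn; lia.
  by have := gE _ _ qS' qn; rewrite p0 (hE a) //; lia.
- by move=> n /gS'[q qS' qn]; have [_ + _] := hP _ qS'; apply.
have [_ _ [a aS ha]] := hP _ q0S'; exists a => //.
by rewrite (fE _ q0) // ?ha // gq0.
Qed.

Lemma span_trans A S : disjoint_terms S ->
  S `<=` span (terms A) -> span S `<=` span (terms A).
Proof.
move=> dS SA p /(span_spanned dS) Sp; apply: spanned_span.
by apply: spanned_trans Sp => // [|q /SA/spanP//]; exact: terms_disjoint.
Qed.

Lemma ble_span A B : ble A B -> span (terms A) `<=` span (terms B).
Proof. by apply: span_trans; exact: terms_disjoint. Qed.

Lemma ble_refl A : ble A A.
Proof. exact: span_sub. Qed.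

Lemma ble_trans A B C : ble A B -> ble B C -> ble A C.
Proof. by move=> AB BC p /AB; exact: ble_span. Qed.

(** * Which terms an element of a span uses *)

Lemma span_peaks B p m : span (terms B) p -> 0 < p m ->
  exists b, [/\ terms B b, 0 < b m & forall n, b n = k :> nat -> 0 < p n].
Proof.
move=> /spanP[g [gE gS _]] pm; have [b bB bm] := gS _ pm.
(* Contributing at [m], the term [b] has shift below k, so its peaks survive in [p]. *)
exists b; split=> // n bn; rewrite (gE b) ?bn // subn_gt0.
by have := gE _ _ bB bm; have := ltn_ord (b m); lia.
Qed.

(** A term used by [q] is still positive in [q] at its peaks, hence lies in [S]; so the shifts of
    [q] over [terms B] also work over [S]. *)
Lemma span_used S A B q : S `<=` terms B -> S `<=` span (terms A) ->
  span (terms B) q ->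
  (forall a n, terms B a -> a n = k :> nat -> 0 < q n -> S a) ->
  span (terms A) q.
Proof.
move=> SB SA /spanP[h [hE hS [a0 a0B ha0]]] used.
have usedS a : terms B a -> h a < k -> S a.
  move=> aB ha; have [n an] := FIN_peak a.
  by apply: (used a n) => //; rewrite (hE a) ?an // subn_gt0.
apply: spanned_span; apply: (@spanned_trans _ S).
- exact: terms_disjoint.
- by move=> x y n /SB xB /SB yB; exact: (terms_disjoint xB).
- by move=> x /SA/spanP.
exists h; split.
- by move=> a n /SB aB; exact: hE.
- move=> n qn; have [a aB an] := hS _ qn; exists a => //; apply: usedS => //.
  by have := hE _ _ aB an; have := ltn_ord (a n); lia.
by exists a0 => //; apply: usedS; rewrite ?ha0.
Qed.

(* A term used by [q] cannot meet [p]: superlevel sets of the same term share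
   the points where it takes the value [k]. *)
Lemma span_above B A p q : span (terms B) p -> span (terms B) q -> blt p q ->
  bleS (above B [:: p]) (terms A) -> span (terms A) q.
Proof.
move=> pB qB /bltP pq BA.
apply: (@span_used (above B [:: p]) _ B) => // [x []//|a i aB ai qi].
split=> //; apply/beforeP => y; rewrite inE => /eqP->.
apply/bltP => m n pm an.
have [b [bB bm bp]] := span_peaks pB pm.
suff /bltP ba : blt b a by exact: ba.
(* The peak j of [b] is in the support of [p], and i in that of [q], so j < i. Thus [a] cannot
   precede [b], and [a = b] would put i in both supports. *)
have [j bj] := FIN_peak b; have pj := bp _ bj; have ji := pq _ _ pj qi.
case: (bB) (aB) => b' _ eb [a' _ ea].
case: (ltngtP b' a') => [ba|ab|e]; first by rewrite -ea -eb; exact: infBlockP.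
  by have /bltP/(_ i j) := infBlockP B ab; rewrite ea eb ai bj => /(_ hk hk); lia.
have e' : b = a by rewrite -ea -eb e.
by have := pq i i (bp i _) qi; rewrite ltnn e' => /(_ ai).
Qed.

(** * Finiteness below a bound *)

Lemma finite_bounded_FIN n :
  exists L : seq (FIN k), forall x, smax (finsupp x) <= n -> x \in L.
Proof.
pose enc x : {ffun 'I_n.+1 -> 'I_k.+1} := [ffun i : 'I_n.+1 => x i].
have encI x y : smax (finsupp x) <= n -> smax (finsupp y) <= n ->
    enc x = enc y -> x = y.
  move=> xn yn exy; apply/val_inj/fsfunP => i /=.
  have [ni|ni] := leqP i n.
    by move/ffunP/(_ (Ordinal (ni : i < n.+1))): exy; rewrite !ffunE.
  have out (z : FIN k) : smax (finsupp z) <= n -> z i = ord0.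
    move=> zn; apply/eqP; apply: contraLR ni => zi.
    have : i \in finsupp z by rewrite mem_FIN lt0n; exact: zi.
    by move=> /smax_ge; lia.
  by rewrite (out x) // (out y).
have /choice[d dP] : forall f, exists o : option (FIN k),
    forall x, smax (finsupp x) <= n -> enc x = f -> o = Some x.
  move=> f; have [[x [xn xf]]|N] :=
    pselect (exists x, smax (finsupp x) <= n /\ enc x = f).
    by exists (Some x) => y yn yf; rewrite (encI x y) // yf.
  by exists None => x xn xf; case: N; exists x.
exists (pmap d (enum {ffun 'I_n.+1 -> 'I_k.+1})) => x xn.
by rewrite mem_pmap; apply/mapP; exists (enc x); rewrite ?mem_enum // (dP _ x).
Qed.

(** Blocks in a block sequence are distinct, which bounds its length. This finiteness lets one stage
    of a fusion serve all sequences bounded by n. *)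
Lemma finite_bounded_blocks n : exists L : seq (seq (FIN k)), forall c,
  pairwise (@blt k) c -> (forall x, x \in c -> smax (finsupp x) <= n) -> c \in L.
Proof.
have [L0 L0P] := finite_bounded_FIN n.
suff words m : exists L : seq (seq (FIN k)), forall c,
    size c <= m -> {subset c <= L0} -> c \in L.
  have [L LP] := words (size L0); exists L => c cP cn.
  have cL0 : {subset c <= L0} by move=> x /cn/L0P.
  by apply: LP => //; apply: uniq_leq_size => //; exact: blt_uniq.
elim: m => [|m [L LP]]; first by exists [:: [::]] => -[].
exists ([::] :: [seq x :: c | x <- L0, c <- L]) => -[|x c] //= cm cL0.
rewrite inE /=; apply: allpairs_f; first by rewrite cL0 ?mem_head.
by apply: LP => // y yc; rewrite cL0 // inE yc orbT.
Qed.

(** * Grafting and cones *)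

Definition follows c x := forall y, y \in c -> blt y x.

Lemma graft c A : pairwise (@blt k) c -> (forall i, follows c (A i)) ->
  exists B : infBlock k, mkseq B (size c) = c /\ forall i, B (size c + i) = A i.
Proof.
move=> /(pairwiseP (A 0)) cP cA.
pose f i := if i < size c then nth (A 0) c i else A (i - size c).
have fP m n : m < n -> blt (f m) (f n).
  rewrite /f => mn; have [nc|nc] := ltnP n (size c).
    by rewrite (ltn_trans mn nc); apply: cP => //; exact: ltn_trans nc.
  case: ltnP => mc; first by apply: cA; exact: mem_nth.
  by apply: infBlockP; lia.
exists (MkInfBlock fP); split=> [|i] /=.
  apply: (@eq_from_nth _ (A 0)) => [|i]; rewrite size_mkseq // => ic.
  by rewrite nth_mkseq //= /f ic.
by rewrite /f ltnNge leq_addr addKn.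
Qed.

(** [basic] for a raw list, so that [rcons] and [++] carry no block proof; the cone is empty if [c]
    is not a block sequence. *)
Definition cone c A : set (infBlock k) :=
  [set B : infBlock k | (exists n, c = mkseq B n) /\ above B c `<=` span (terms A)].

Lemma mkseq_pairwise A n : pairwise (@blt k) (mkseq A n).
Proof.
rewrite /mkseq pairwise_map -sorted_pairwise; last by move=> ? ? ?; exact: blt_trans.
by apply: sub_sorted (iota_ltn_sorted 0 n) => i i'; exact: infBlockP.
Qed.

Lemma mkseq_follows A i j : i <= j -> follows (mkseq A i) (A j).
Proof.
move=> ij _ /mapP[m + ->]; rewrite mem_iota => /andP[_ mi].
by apply: infBlockP; exact: leq_trans ij.
Qed.

Lemma coneP c A B : cone c A B <->
  mkseq B (size c) = c /\ forall i, size c <= i -> span (terms A) (B i).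
Proof.
split=> [[[n ->] BA]|[cE BA]].
  rewrite size_mkseq; split=> // i ni; apply: BA; split; first by exists i.
  by apply/beforeP; exact: mkseq_follows.
split; first by exists (size c).
move=> _ [[i _ <-] /beforeP ci]; apply: BA; rewrite leqNgt; apply/negP => ic.
have : blt (B i) (B i) by apply: ci; rewrite -cE map_f // mem_iota.
by rewrite blt_irr.
Qed.

Lemma basicE (a : finBlock k) A : basic a A = cone a A.
Proof. by []. Qed.

Lemma coneS c A B i : cone c A B -> size c <= i -> span (terms A) (B i).
Proof. by case/coneP=> _ BA /BA. Qed.

Lemma cone_pairwise c A B : cone c A B -> pairwise (@blt k) c.
Proof. by case/coneP=> <- _; exact: mkseq_pairwise. Qed.

Lemma cone_follows c A B i : cone c A B -> size c <= i -> follows c (B i).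
Proof. by case/coneP=> cE _; rewrite -{2}cE; exact: mkseq_follows. Qed.

(** A term of [B] within [c] ends before [q] starts, so [q] uses later terms only. *)
Lemma cone_span c A B q :
  cone c A B -> span (terms B) q -> follows c q -> span (terms A) q.
Proof.
move=> /coneP[cE BA] qB cq.
apply: (@span_used [set B i | i in [set i | size c <= i]] _ B) => //.
- by move=> _ [i _ <-]; exists i.
- by move=> _ [i ci <-]; exact: BA.
move=> _ n [i _ <-] Bn qn; exists i => //=; rewrite leqNgt; apply/negP => ic.
have /bltP : blt (B i) q by apply: cq; rewrite -cE map_f // mem_iota.
by move=> /(_ n n); rewrite Bn ltnn => /(_ hk qn).
Qed.

(** The weakening of [ble A A'] that a diagonalization provides: it compares spans only past [c],
    which is all that cones at [c] see. *)
Definition covers c A A' :=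
  forall q, span (terms A) q -> follows c q -> span (terms A') q.

Lemma cone_cover c A A' : covers c A A' -> cone c A `<=` cone c A'.
Proof.
move=> AA' B cB; have [cE BA] := (coneP _ _ _).1 cB; apply/coneP; split=> // i ci.
by apply: AA'; [exact: BA | exact: cone_follows cB ci].
Qed.

Lemma cone_ble c A A' : ble A A' -> cone c A `<=` cone c A'.
Proof. by move=> /ble_span AA'; apply: cone_cover => q /AA'. Qed.

Lemma graft_cone c A : pairwise (@blt k) c -> (forall i, follows c (A i)) ->
  exists B : infBlock k, cone c A B /\ forall i, B (size c + i) = A i.
Proof.
move=> cc cA; have [B [cE BA]] := graft cc cA; exists B; split=> //.
apply/coneP; split=> // i /subnKC <-; rewrite BA.
by apply: span_sub; exists (i - size c).
Qed.

Lemma follows_span c A p :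
  (forall i, follows c (A i)) -> span (terms A) p -> follows c p.
Proof.
move=> cA pA y yc; apply/bltP => m n ym pn.
have [_ [i _ <-] Ain] := span_supp pA pn.
by have /bltP := cA i y yc; apply.
Qed.

End Blocks.

(** * Coideals and fusion *)

Section Coideal.
Variables (k : nat) (hk : 0 < k) (H : set (infBlock k)).
Hypothesis Hcoideal : coideal H.
Implicit Types (p q : FIN k) (c : seq (FIN k)) (A B : infBlock k).

Lemma coideal_up A B : ble A B -> H A -> H B.
Proof. exact: Hcoideal.1. Qed.

(* Of the two pieces of [A], the terms that do not follow [c] are finitely
   many, so they span no infinite block sequence. *)
Lemma coideal_tail A c : H A ->
  exists B : infBlock k, [/\ H B, ble B A & forall i, follows c (B i)].
Proof.
move=> HA; pose C := above A c.
have [|D HD [DC|DC]] := Hcoideal.2 A C (terms A `\` C) HA _ (setDIK _ _).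
- by rewrite setDUK // => p [].
- exists D; split=> // [|i y yc].
    by apply: subset_trans DC _; apply: span_mono => p [].
  apply/(bltP hk) => m n ym Dn.
  have Di : terms D (D i) by exists i.
  have [a [_ /(beforeP hk)/(_ _ yc)/(bltP hk) ya] an] := span_supp (DC _ Di) Dn.
  exact: ya.
(* Terms of [A] of index at least [M] start past [c]. Earlier ones end before the peak [N] of [A M],
   while [D N] starts at [N] or later. *)
pose M := (\max_(y <- c) smax (finsupp y)).+1.
have [N AN] := FIN_peak (A M).
have [n Dn] := FIN_peak (D N).
have Dn0 : 0 < D N n by rewrite Dn.
have DN : terms D (D N) by exists N.
have [_ [[i _ <-] nC] an] := span_supp (DC _ DN) Dn0.
have Nn := term_index_le hk Dn0.
have [iM|Mi] := ltnP i M.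
  have /(bltP hk)/(_ n N an) := infBlockP A iM; rewrite AN => /(_ hk); lia.
case: nC; split; first by exists i.
apply/(beforeP hk) => y yc; apply/(bltP hk) => m j ym Aj.
apply: leq_trans (leq_trans _ Mi) (term_index_le hk Aj); rewrite ltnS.
by apply: leq_trans (leq_bigmax_seq y yc isT); apply: smax_ge; rewrite mem_FIN.
Qed.

Lemma dense_open_all (D : seq (FIN k) -> set (infBlock k)) (L : seq (seq (FIN k))) :
  (forall c, dense_open H (D c)) ->
  dense_open H [set A | H A /\ forall c, c \in L -> D c A].
Proof.
move=> Ddo; split=> [A []//|A B [HB BD] HA AB|A HA].
  by split=> // c /BD DcB; case: (Ddo c) => _ /(_ A B DcB HA AB).
elim: L => [|c L [B [HB BL] BA]]; first by exists A => //; exact: ble_refl.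
case: (Ddo c) => DH Dop /(_ _ HB)[C DC CB].
exists C; last exact: (ble_trans hk) BA.
split=> [|c']; first exact: DH.
rewrite inE => /predU1P[->//|/BL DB].
by case: (Ddo c') => _ + _; apply; [exact: DB | exact: DH | ].
Qed.

Lemma blt_smax (x y : FIN k) : blt x y -> smax (finsupp x) <= smax (finsupp y).
Proof.
move=> /(bltP hk) xy; apply/bigmax_leqP_seq => n + _; rewrite mem_FIN => xn.
have [m ym] := FIN_peak y; have ym0 : 0 < y m by rewrite ym.
by apply: leq_trans (ltnW (xy _ _ xn ym0)) _; apply: smax_ge; rewrite mem_FIN.
Qed.

Hypothesis Hsemi : semiselective H.

(** Stage n treats all block sequences bounded by n. If [b] ends in [p], all of [a ++ b] is bounded
    by the maximum n of the support of [p]; so [An n] is in [D (a ++ b)], and it spans whatever [B]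
    spans after [p]. *)
Lemma semiselective_fusion (D : seq (FIN k) -> set (infBlock k)) A a :
  (forall c, dense_open H (D c)) -> H A ->
  exists2 B : infBlock k, below H A B & forall b,
    pairwise (@blt k) (a ++ b) -> (forall p, p \in b -> span (terms B) p) ->
    exists2 A', D (a ++ b) A' & covers (a ++ b) B A'.
Proof.
move=> Ddo HA.
(* An empty [b] has no last block to select a stage, so [A] is first shrunk into [D a]. *)
have [DH _ /(_ _ HA)[A0 DA0 A0A]] := Ddo a.
have [L LP] := choice (finite_bounded_blocks hk).
have [An [Adec AnD [B [HB BA0] Bdiag]]] :=
  Hsemi (DH _ DA0) (fun n => dense_open_all (L n) Ddo).
exists B; first by split=> //; exact: (ble_trans hk) A0A.
elim/last_ind => [|b p _].
  by rewrite cats0 => *; exists A0 => // q /(ble_span hk BA0).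
rewrite -rcons_cat pairwise_rcons => /andP[/allP abp abP] Bb.
have pB : span (terms B) p by apply: Bb; rewrite mem_rcons mem_head.
exists (An (smax (finsupp p))).
  have [_] := AnD (smax (finsupp p)); apply; apply: LP.
    by rewrite pairwise_rcons abP andbT; apply/allP.
  by move=> x; rewrite mem_rcons inE => /predU1P[->//|/abp/blt_smax].
move=> q qB cq; apply: (span_above hk pB qB) (Bdiag _ pB).
by apply: cq; rewrite mem_rcons mem_head.
Qed.

(** * Acceptance and rejection *)

Section Forcing.
Variable X : set (infBlock k).

Definition accepts A c := cone c A `<=` X.
Definition rejects A c := forall B, below H A B -> ~ accepts B c.

Lemma accepts_covers c A A' : covers c A A' -> accepts A' c -> accepts A c.
Proof. by move=> AA' A'X B /(cone_cover hk AA')/A'X. Qed.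

Lemma ble_covers c A A' : ble A A' -> covers c A A'.
Proof. by move=> /(ble_span hk) AA' q /AA'. Qed.

(** An accepting [B] below [A] need not be below [A'], but the [D] in [H] that [coideal_tail] gives
    below [B] and past [c] is. *)
Lemma rejects_covers c A A' : covers c A A' -> rejects A' c -> rejects A c.
Proof.
move=> AA' A'c B [HB BA] Bc.
have [D [HD DB Dc]] := coideal_tail c HB.
apply: A'c (accepts_covers (ble_covers DB) Bc); split=> // _ [i _ <-].
by apply: AA' (Dc i); apply: (ble_span hk BA); apply: DB; exists i.
Qed.

Lemma accepts_vacuous c A : ~~ pairwise (@blt k) c -> accepts A c.
Proof. by move=> /negP cP B /(cone_pairwise hk). Qed.

Lemma accepts_not_rejects c A : H A -> accepts A c -> ~ rejects A c.
Proof. by move=> HA Ac /(_ A); apply=> //; split=> //; exact: ble_refl. Qed.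

Lemma dense_open_decides c :
  dense_open H [set A | H A /\ (accepts A c \/ rejects A c)].
Proof.
split=> [A []//|A B [HB Bc] HA AB|A HA].
  split=> //; case: Bc => Bc; [left|right].
    by apply: accepts_covers Bc; exact: ble_covers.
  by apply: rejects_covers Bc; exact: ble_covers.
have [Ac|nAc] := pselect (rejects A c).
  by exists A; [split=> //; right | exact: ble_refl].
have /existsNP[B /not_implyP[[HB BA] /contrapT Bc]] := nAc.
by exists B => //; split=> //; left.
Qed.

Hypothesis Hgowers : gowers H.

Lemma dense_open_rejects_rcons c : dense_open H
  [set A | H A /\ (accepts A c \/ rejects A c /\
    forall p, span (terms A) p -> follows c p -> rejects A (rcons c p))].
Proof.
split=> [A []//|A B [HB Bc] HA AB|A HA].
  split=> //; case: Bc => [Bc|[Bc Bcp]]; [left|right].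
    by apply: accepts_covers Bc; exact: ble_covers.
  split; first by apply: rejects_covers Bc; exact: ble_covers.
  move=> p pA cp; apply: rejects_covers (Bcp p _ cp); first exact: ble_covers.
  exact: ble_span pA.
have [cP|cP] := boolP (pairwise (@blt k) c); last first.
  by exists A; [split=> //; left; exact: accepts_vacuous | exact: ble_refl].
(* Fusing the decisions gives one [B] that decides [c] and every [rcons c p] with [p] in its span
   past [c]. *)
have [B [HB BA] Bdec] := semiselective_fusion c dense_open_decides HA.
have dec b : pairwise (@blt k) (c ++ b) -> (forall p, p \in b -> span (terms B) p) ->
    accepts B (c ++ b) \/ rejects B (c ++ b).
  move=> cb bB; have [A' [_ [A'a|A'r]] BA'] := Bdec b cb bB; [left|right].
    exact: accepts_covers A'a.
  exact: rejects_covers A'r.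
have [Bc|Bc] : accepts B c \/ rejects B c by have := dec [::]; rewrite cats0; exact.
  by exists B => //; split=> //; left.
have [B1 [HB1 B1B B1c]] := coideal_tail c HB.
pose f p : 'I_2 := if `[< accepts B (rcons c p) >] then ord_max else ord0.
have [C [HC CB1] [e fe]] := Hgowers f isT HB1.
have CB : ble C B := ble_trans hk CB1 B1B.
have Cc p : span (terms C) p -> follows c p.
  by move=> /(ble_span hk CB1); exact: follows_span.
exists C; last exact: (ble_trans hk) BA.
split=> //; right; split; first by apply: rejects_covers Bc; exact: ble_covers.
move=> p pC cp.
have pB : span (terms B) p by exact: ble_span pC.
apply: (@rejects_covers _ _ B); first exact: ble_covers.
have [|//] : accepts B (rcons c p) \/ rejects B (rcons c p).
  rewrite -cats1; apply: dec => [|q]; last by rewrite inE => /eqP->.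
  by rewrite cats1 pairwise_rcons cP andbT; apply/allP => y /cp.
(* If the colour were acceptance, take [G] in [cone c C]. Its next block [q] has the same colour, so
   [B] accepts [rcons c q] and [G] is in [X]. Thus [C] would accept [c], which [B] rejects. *)
move=> Bp; exfalso; apply: (Bc C) => // G cG.
pose q := G (size c).
have qC : span (terms C) q by exact: coneS cG _.
have Bq : accepts B (rcons c q).
  by have := fe _ qC; rewrite -(fe _ pC) /f (asboolT Bp); case: asboolP.
apply: Bq; apply/(coneP hk); have [cE GC] := (coneP hk _ _ _).1 cG.
rewrite size_rcons mkseqS cE; split=> // i ci.
by apply: (ble_span hk CB); apply: GC; exact: ltnW.
Qed.

(** Induction on [b] from the right: as [B] rejects [a ++ b], the sequence supplied by the fusion
    cannot accept it, hence rejects its one-block extensions. *)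
Lemma rejects_extensions A a : H A -> rejects A a ->
  exists2 B : infBlock k, below H A B & forall b,
    pairwise (@blt k) (a ++ b) -> (forall p, p \in b -> span (terms B) p) ->
    rejects B (a ++ b).
Proof.
move=> HA Aa.
have [B [HB BA] BP] := semiselective_fusion a dense_open_rejects_rcons HA.
exists B => //; elim/last_ind => [|b p IH].
  by rewrite cats0 => _ _; apply: rejects_covers Aa; exact: ble_covers.
rewrite -rcons_cat pairwise_rcons => /andP[/allP abp abP] bB.
have bB' q : q \in b -> span (terms B) q.
  by move=> qb; apply: bB; rewrite mem_rcons inE qb orbT.
have pB : span (terms B) p by apply: bB; rewrite mem_rcons mem_head.
have [A' [_ [A'a|[_ A'p]]] BA'] := BP b abP bB'.
  by case: (accepts_not_rejects HB (accepts_covers BA' A'a)); exact: IH.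
have cp : follows (a ++ b) p by move=> y /abp.
apply: rejects_covers (A'p p (BA' _ pB cp) cp) => q qB qc.
by apply: BA' => // y yab; apply: qc; rewrite mem_rcons inE yab orbT.
Qed.

End Forcing.

(* Nothing forces [b] to extend [a], so pass to an initial segment, longer than
   both, of some member of the cone [b, B]. *)
Lemma cone_sub_refine X A a b B :
  H B -> cone b B `<=` cone a A -> cone b B `<=` X ->
  pairwise (@blt k) b ->
  exists c D, [/\ below H A D, accepts X D (a ++ c), pairwise (@blt k) (a ++ c)
    & forall p, p \in c -> span (terms A) p].
Proof.
move=> HB baA bX bP.
have [B1 [HB1 B1B B1b]] := coideal_tail b HB.
have [F [bF FE]] := graft_cone hk bP B1b.
have bBF := cone_ble hk B1B bF.
have [[aE FA] [bE FB]] := ((coneP hk _ _ _).1 (baA _ bBF), (coneP hk _ _ _).1 bBF).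
pose n := maxn (size a) (size b).
have [c cE] : exists c, mkseq F n = a ++ c.
  exists (map F (iota (size a) (n - size a))).
  by rewrite -{1}aE /mkseq -map_cat -iotaD subnKC // leq_maxl.
have [D [HD DB1 Dc]] := coideal_tail (mkseq F n) HB.
have sub : cone (mkseq F n) D `<=` cone b B.
  move=> G nG; have [GE GD] := (coneP hk _ _ _).1 nG; rewrite size_mkseq in GE GD.
  have GF i : i < n -> G i = F i.
    by move=> ni; rewrite -(nth_mkseq (F 0) G ni) GE nth_mkseq.
  apply/(coneP hk); split=> [|i bi].
    rewrite -bE size_mkseq; apply/eq_in_map => i; rewrite mem_iota => /andP[_ ib].
    by apply: GF; rewrite leq_max ib orbT.
  have [ni|ni] := ltnP i n; first by rewrite GF //; exact: FB.
  by apply: (ble_span hk DB1); exact: GD.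
have nP := mkseq_pairwise hk F n.
exists c, D; rewrite -cE; split=> //.
(* Grafting [D] after the segment gives a member of [cone a A], whose terms past [a] lie in the span
   of [A]. *)
- split=> // _ [i _ <-].
  have [G [nG GE]] := graft_cone hk nP Dc.
  by rewrite -GE; apply: (coneS hk (baA _ (sub _ nG))); rewrite size_mkseq /n; lia.
- by move=> G /sub/bX.
move=> p pc; have : p \in drop (size a) (mkseq F n) by rewrite cE drop_size_cat.
rewrite /mkseq -map_drop drop_iota => /mapP[i]; rewrite mem_iota => /andP[ai _] ->.
exact: FA.
Qed.

(** * From Baire to Ramsey *)

Hypothesis Hgowers : gowers H.

Lemma Baire_Ramsey X : H_Baire H X -> H_Ramsey H X.
Proof.
move=> XB A a HA.
(* Acceptance below [A] suffices: grafting [a] before some [D <= B] in [H] past [a] gives a member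
   [E] of [basic a A], in [H] because [D <= E]. *)
suff [B [HB BA] Ba] : exists2 B, below H A B & accepts X B a \/ accepts (~` X) B a.
  have [D [HD DB Da]] := coideal_tail a HB.
  have aP : pairwise (@blt k) a by case: (a).
  have [E [aE ED]] := graft_cone hk aP Da.
  have DE : ble D E by move=> _ [i _ <-]; apply: span_sub; exists (size a + i).
  have EB : basic a E `<=` basic a B.
    by apply: cone_cover => // q qE aq; apply: (ble_span hk DB); exact: cone_span qE aq.
  exists E.
    split; last exact: coideal_up DE HD.
    by rewrite basicE; apply: cone_ble aE => //; exact: ble_trans hk _ _ _ DB BA.
  case: Ba => Ba; [left|right]; first exact: subset_trans EB Ba.
  by apply/disjoints_subset; exact: subset_trans EB Ba.
apply: contrapT => N.
have rej Y : (Y = X \/ Y = ~` X) -> rejects Y A a.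
  by move=> YX B AB Ba; apply: N; exists B => //; case: YX Ba => ->; [left|right].
have [B [HB BA] Brej] := rejects_extensions Hgowers HA (rej X (or_introl erefl)).
have rejB : rejects (~` X) B a.
  by apply: rejects_covers (rej _ (or_intror erefl)); exact: ble_covers.
have [C [HC CB] Crej] := rejects_extensions Hgowers HB rejB.
have [b [E [HE Ea EX]]] := XB C a HC.
have bP : pairwise (@blt k) b by case: (b).
(* Either way, refining the cone yields an accepted extension [a ++ c] that [B] or [C] rejects. *)
have [EbX|/disjoints_subset EbX] := EX.
  have [c [D [CD Dc acP cC]]] := cone_sub_refine HE Ea EbX bP.
  apply: (Brej c acP _ D) => //; first by move=> p /cC/(ble_span hk CB).
  by case: CD => HD DC; split=> //; exact: ble_trans hk _ _ _ DC CB.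
have [c [D [CD Dc acP cC]]] := cone_sub_refine HE Ea EbX bP.
exact: (Crej c acP cC D).
Qed.

Lemma basic_sub_cone (a : finBlock k) A B :
  basic a A B -> basic a B `<=` basic a A.
Proof. by move=> aB; apply: cone_cover => // q; exact: cone_span aB. Qed.

Lemma basic_nonempty (a : finBlock k) A : H A -> exists B, basic a A B.
Proof.
move=> HA; have [D [HD DA Da]] := coideal_tail a HA.
have [|E [aE _]] := graft_cone hk _ Da; first by case: (a).
by exists E; rewrite basicE; exact: cone_ble aE.
Qed.

(** The other side of the Ramsey dichotomy is a cone inside [X]; it would contain a nonempty cone
    disjoint from [X]. *)
Lemma nowhere_dense_Ramsey_null X : H_nowhere_dense H X -> H_Ramsey_null H X.
Proof.
move=> Xnd A a HA.
have XB : H_Baire H X.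
  by move=> A' a' /(Xnd A' a')[b [B [HB ba bX]]]; exists b, B; split=> //; right.
have [B [aB HB] [BX|BX]] := Baire_Ramsey XB a HA; last by exists B.
have [b [C [HC Cb /disjoints_subset CX]]] := Xnd B a HB.
have [G bG] := basic_nonempty b HC.
by case: (CX G bG); apply/BX/Cb.
Qed.

End Coideal.

Theorem theorem3 (k : nat) (hk : (1 <= k)%N) (H : set (infBlock k))
    (Hcoideal : coideal H) (Hgowers : gowers H) (Hsemi : semiselective H)
    (X : set (infBlock k)) :
  (H_Ramsey H X <-> H_Baire H X) /\
  (H_Ramsey_null H X <-> H_nowhere_dense H X).
Proof.
split; split.
- move=> XR A a HA; have [B [aB HB] BX] := XR A a HA.
  by exists a, B; split=> //; exact: basic_sub_cone.
- exact: Baire_Ramsey.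
- move=> XR A a HA; have [B [aB HB] BX] := XR A a HA.
  by exists a, B; split=> //; exact: basic_sub_cone.
exact: nowhere_dense_Ramsey_null.
Qed.
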